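(* Let $d\ge 2$ and let $\gamma_d$ be the infimum of the set of all $\gamma\ge 0$ for which the equation $\exp(-\gamma(1-x)^d)=x$ has a solution $x<1$. Let $c<\gamma_d$ be fixed. Then in the probability space $Y_d(n,\frac{c}{n})$, $$\lim_{n\to\infty}\Pr\big[Y \text{ is } d\text{-collapsible} \;\big|\; Y\in\mathcal{F}_{n,d}\big]=1.$$
   Context: $\Delta_{n-1}$ denotes the $(n-1)$-dimensional simplex on vertex set $[n]$, $\Delta_{n-1}^{(i)}$ its $i$-skeleton and $\Delta_{n-1}(i)$ its set of $i$-dimensional faces. $Y_d(n,p)$ is the probability space of complexes $\Delta_{n-1}^{(d-1)}\subset Y\subset\Delta_{n-1}^{(d)}$ in which each $d$-simplex is included independently with probability $p$. A $(d-1)$-simplex $\tau$ is a free face of a complex $Y\subset\Delta_{n-1}^{(d)}$ if it is contained in exactly one $d$-simplex of $Y$. $R(Y)$ is the complex obtained from $Y$ by removing all free $(d-1)$-faces of $Y$ together with the $d$-simplices containing them; $R_0(Y)=Y$, $R_i(Y)=R(R_{i-1}(Y))$, and $R_\infty(Y)$ is the eventual stable complex. $Y$ is $d$-collapsible if $\dim R_\infty(Y)<d$. $\mathcal{F}_{n,d}$ is the family of all complexes $\Delta_{n-1}^{(d-1)}\subset Y\subset\Delta_{n-1}^{(d)}$ that do not contain the boundary of a $(d+1)$-simplex. *)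

(* Defs.v *)
From HB Require Import structures.
From mathcomp Require Import all_boot all_order all_algebra.
From mathcomp Require Import all_classical all_reals all_analysis.
Set Implicit Arguments. Unset Strict Implicit. Unset Printing Implicit Defensive.
Import Order.TTheory GRing.Theory Num.Theory.
Local Open Scope ring_scope.

(* A complex Delta^{(d-1)}_{n-1} ⊂ Y ⊂ Delta^{(d)}_{n-1} is determined by its
   set of d-simplices S, a set of (d+1)-element subsets of the vertex set 'I_n. *)

Definition dfaces (n d : nat) : {set {set 'I_n}} := [set s : {set 'I_n} | #|s| == d.+1].

Definition free_face (n : nat) (S : {set {set 'I_n}}) (t : {set 'I_n}) : bool :=
  #|[set s in S | t \subset s]| == 1%N.

Definition Rstep (n d : nat) (S : {set {set 'I_n}}) : {set {set 'I_n}} :=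
  [set s in S | ~~ [exists t : {set 'I_n},
                     [&& #|t| == d, t \subset s & free_face S t]]].

(* Y is d-collapsible: the eventual stable complex R_oo(Y) has no d-simplex,
   i.e. some iterate R_k(Y) has no d-simplex. *)
Definition d_collapsible (n d : nat) (S : {set {set 'I_n}}) : Prop :=
  exists k : nat, iter k (Rstep d) S = finset.set0.

(* Y ∈ F_{n,d}: Y does not contain the boundary of a (d+1)-simplex. *)
Definition in_F (n d : nat) (S : {set {set 'I_n}}) : bool :=
  ~~ [exists T : {set 'I_n}, (#|T| == d.+2) &&
        [forall s : {set 'I_n}, ((s \subset T) && (#|s| == d.+1)) ==> (s \in S)]].

Definition Yprob (R : realType) (n d : nat) (p : R)
    (E : {set {set 'I_n}} -> bool) : R :=
  \sum_(S : {set {set 'I_n}} | (S \subset dfaces n d) && E S)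
     p ^+ #|S| * (1 - p) ^+ (#|dfaces n d| - #|S|).

Definition Ycondprob (R : realType) (n d : nat) (p : R)
    (A B : {set {set 'I_n}} -> bool) : R :=
  @Yprob R n d p (fun S => A S && B S) / @Yprob R n d p B.

Definition gamma_d (R : realType) (d : nat) : R :=
  inf [set g : R | 0 <= g /\ exists x : R, x < 1 /\ expR (- (g * (1 - x) ^+ d)) = x].

(* Main.v *)
(* If Y is not d-collapsible, it contains a core K: a nonempty set of d-simplices
   in which every (d-1)-face lies in at least two simplices.  First moments show
   that a.a.s. every set of m simplices of Y, m up to a multiple of log log n, has
   at least m vertices.  A core without the boundary of a (d+1)-simplex has fewer
   vertices than simplices (compare vertex degrees with d+1), so K is not small;
   and after adjoining boundedly many short cycles, K continues outwards as a tree
   for r steps: from some (d-1)-face one can grow in Y a d-ary tree of depth r with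
   pairwise distinct simplices.  By the van den Berg-Kesten inequality (distinct
   branches are disjointly occurring events) and Harris' inequality (the choices of
   the new vertex), the probability of such a tree is at most the r-th iterate of
   t |-> 1 - exp(-c' t^d) at 1, where c < c' < gamma_d.  These iterates tend to 0,
   doubly exponentially fast, and so beat the n^d choices of the root when r is of
   order log log n.  Harris' inequality also bounds Pr[Y in F] from below. *)

Require Import Defs.
From HB Require Import structures.
From mathcomp Require Import all_classical all_reals all_analysis.
From mathcomp Require Import all_boot all_order all_algebra.
From mathcomp Require Import ring lra zify.
Set Implicit Arguments. Unset Strict Implicit. Unset Printing Implicit Defensive.
Import Order.TTheory GRing.Theory Num.Theory.
Import numFieldNormedType.Exports.
Local Open Scope ring_scope.

(** * Random subsets: the Harris and van den Berg-Kesten inequalities *)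

Section RandomSubset.
Variables (R : realFieldType) (T : finType) (p : R).
Implicit Types (D S U : {set T}) (A B : {set T} -> bool) (f g : {set T} -> R).

Definition mean D f : R :=
  \sum_(S : {set T} | S \subset D) p ^+ #|S| * (1 - p) ^+ (#|D| - #|S|) * f S.

(** Same body as [Yprob], with a general ground set [D], so that the two are convertible for
    [D = dfaces n d]. *)
Definition Pr D A : R :=
  \sum_(S : {set T} | (S \subset D) && A S)
     p ^+ #|S| * (1 - p) ^+ (#|D| - #|S|).

Lemma PrE D A : Pr D A = mean D (fun S => (A S)%:R).
Proof.
rewrite /Pr /mean big_mkcondr /=; apply: eq_bigr => S _.
by case: (A S); rewrite ?mulr1 ?mulr0.
Qed.

Lemma mean0 f : mean set0 f = f set0.
Proof.
rewrite /mean (big_pred1 set0) => [|S]; last by rewrite subset0.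
by rewrite cards0 !expr0 !mul1r.
Qed.

(** Conditioning on whether [e] is kept. Together with [setU1_ind] this drives the proofs of both
    correlation inequalities. *)
Lemma meanU1 e D f : e \notin D ->
  mean (e |: D) f = p * mean D (fun S => f (e |: S)) + (1 - p) * mean D f.
Proof.
move=> eD; rewrite /mean (bigID (fun S : {set T} => e \in S)) /=.
have subD S : (S \subset e |: D) && (e \notin S) = (S \subset D).
  apply/andP/idP => [[sSD eS]|sSD].
    apply/subsetP => x xS; have := subsetP sSD _ xS.
    by rewrite !inE => /orP[/eqP xe|//]; rewrite -xe xS in eS.
  split; first by rewrite subsetU // sSD orbT.
  by apply: contra eD; apply: (subsetP sSD).
congr (_ + _).
  rewrite (reindex_onto (fun S => e |: S) (fun S => S :\ e)) /=; last first.
    by move=> S /andP[_ eS]; rewrite setD1K.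
  rewrite big_distrr /=; apply: eq_big => [S|S /andP[/andP[_ _] /eqP eS]].
    rewrite setU11 andbT -subD; apply/andP/andP => -[sSD eS].
      by rewrite -(eqP eS) setD11 (eqP eS) (subset_trans (subsetUr _ _) sSD).
    by rewrite setU1K // eqxx subUset sub1set setU11 sSD.
  have eS' : e \notin S by rewrite -eS setD11.
  by rewrite !cardsU1 eS' eD exprD subSS !mulrA.
rewrite big_distrr /=; apply: eq_big => [//|S]; rewrite subD => sS.
by rewrite cardsU1 eD /= add1n subSn ?subset_leq_card // exprS; ring.
Qed.

Lemma setU1_ind (P : {set T} -> Prop) :
  P set0 -> (forall e D, e \notin D -> P D -> P (e |: D)) -> forall D, P D.
Proof.
move=> P0 PU D; have [m] := ubnP #|D|; elim: m D => // m IH D leD.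
have [->//|[e eD]] := set_0Vmem D.
rewrite -(setD1K eD); apply: PU; rewrite ?setD11 //.
by apply: IH; move: leD; rewrite (cardsD1 e) eD.
Qed.

Lemma mean_cst D (a : R) : mean D (fun=> a) = a.
Proof.
by elim/setU1_ind: D => [|e D eD IH]; rewrite ?mean0 // meanU1 // !IH; ring.
Qed.

Lemma meanB D f g : mean D (fun S => f S - g S) = mean D f - mean D g.
Proof. by rewrite /mean -sumrB; apply: eq_bigr => S _; rewrite mulrBr. Qed.

Lemma PrC D A : Pr D (fun S => ~~ A S) = 1 - Pr D A.
Proof.
rewrite !PrE -[X in _ = X - _](mean_cst D) -meanB; apply: eq_bigr => S _.
by case: (A S); rewrite /= ?subrr ?subr0.
Qed.

Lemma Pr_eq D A B : (forall S, S \subset D -> A S = B S) -> Pr D A = Pr D B.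
Proof. by move=> AB; apply: eq_bigl => S; apply: andb_id2l => /AB. Qed.

Lemma PrU1 e D A : e \notin D ->
  Pr (e |: D) A = p * Pr D (fun S => A (e |: S)) + (1 - p) * Pr D A.
Proof. by move=> eD; rewrite !PrE meanU1. Qed.

Lemma Pr_supset D U : U \subset D -> Pr D (fun S => U \subset S) = p ^+ #|U|.
Proof.
elim/setU1_ind: D U => [U|e D eD IH U].
  rewrite subset0 => /eqP->; rewrite PrE mean0 sub0set cards0 expr0 //.
move=> sUD; rewrite PrU1 //; have [eU|eU] := boolP (e \in U).
  have eqU S : S \subset D -> (U \subset e |: S) = (U :\ e \subset S).
    by move=> _; rewrite subDset.
  rewrite (Pr_eq eqU) IH; last by rewrite subDset.
  rewrite (cardsD1 e U) eU exprS.
  suff -> : Pr D (fun S => U \subset S) = 0 by rewrite mulr0 addr0.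
  apply: big_pred0 => S; apply: contraNF eD => /andP[sSD sUS].
  exact: (subsetP sSD) (subsetP sUS _ eU).
have sUD' : U \subset D.
  by rewrite -(setU1K eD) subsetD1 sUD eU.
have eqU S : S \subset D -> (U \subset e |: S) = (U \subset S).
  move=> _; apply/idP/idP => [sUS|/subset_trans->//]; last exact: subsetUr.
  apply/subsetP => x xU; have := subsetP sUS _ xU; rewrite !inE.
  by case/orP=> // /eqP xe; rewrite -xe xU in eU.
by rewrite (Pr_eq eqU) IH //; ring.
Qed.

Hypothesis p01 : 0 <= p <= 1.

Lemma weight_ge0 (a b : nat) : 0 <= p ^+ a * (1 - p) ^+ b.
Proof. by case/andP: p01 => p0 p1; rewrite mulr_ge0 ?exprn_ge0 ?subr_ge0. Qed.

Lemma mean_le D f g : (forall S, S \subset D -> f S <= g S) -> mean D f <= mean D g.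
Proof.
by move=> fg; apply: ler_sum => S /fg; apply: ler_wpM2l; apply: weight_ge0.
Qed.

Lemma Pr_ge0 D A : 0 <= Pr D A.
Proof. by apply: sumr_ge0 => S _; apply: weight_ge0. Qed.

Lemma Pr_le D A B : (forall S, S \subset D -> A S -> B S) -> Pr D A <= Pr D B.
Proof.
move=> AB; rewrite !PrE; apply: mean_le => S /AB.
by case: (A S); case: (B S) => // /(_ isT).
Qed.

Lemma Pr_le1 D A : Pr D A <= 1.
Proof. by rewrite -subr_ge0 -PrC Pr_ge0. Qed.

Lemma Pr_exists (I : finType) (Q : pred I) D (E : I -> {set T} -> bool) :
  Pr D (fun S => [exists i, Q i && E i S]) <= \sum_(i | Q i) Pr D (E i).
Proof.
have -> : \sum_(i | Q i) Pr D (E i) = mean D (fun S => \sum_(i | Q i) (E i S)%:R).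
  rewrite /mean (eq_bigr _ (fun i _ => PrE D (E i))) exchange_big /=.
  by apply: eq_bigr => S _; rewrite mulr_sumr.
rewrite PrE; apply: mean_le => S _.
case: existsP => [[i /andP[Qi EiS]]|_]; last by apply: sumr_ge0 => i _; apply: ler0n.
by rewrite (bigD1 i) //= EiS lerDl; apply: sumr_ge0 => j _; apply: ler0n.
Qed.

Lemma Pr_or D A B : Pr D (fun S => A S || B S) <= Pr D A + Pr D B.
Proof.
rewrite !PrE /mean -big_split /=; apply: ler_sum => S _.
rewrite -mulrDr; apply: ler_wpM2l; first exact: weight_ge0.
by case: (A S); case: (B S); rewrite ?addr0 ?add0r // lerDl.
Qed.

Definition down f := forall S U, S \subset U -> f U <= f S.

(** Condition on one element [e]: the covariance is the average of the conditional covariances,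
    nonnegative by induction, plus the covariance of the conditional means, which is
    [p (1 - p) (f0 - f1) (g0 - g1)]. *)
Lemma harris_mean D f g : down f -> down g ->
  mean D f * mean D g <= mean D (fun S => f S * g S).
Proof.
case/andP: p01 => p0 p1; elim/setU1_ind: D f g => [|e D eD IH] f g df dg.
  by rewrite !mean0.
have downU h : down h -> down (fun S => h (e |: S)) by move=> dh S U sSU; apply/dh/setUS.
have leU h : down h -> mean D (fun S => h (e |: S)) <= mean D h.
  by move=> dh; apply: mean_le => S _; apply/dh/subsetUr.
rewrite !meanU1 //.
have := IH _ _ (downU _ df) (downU _ dg); have := IH _ _ df dg.
have := leU _ df; have := leU _ dg.
set f1 := mean D (fun S => f _); set g1 := mean D (fun S => g (_ |: _)).
set f0 := mean D f; set g0 := mean D g.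
set h1 := mean D (fun S => _ (_ |: _) * _); set h0 := mean D (fun S => _ * _).
move=> leg lef H0 H1.
have le1 := ler_wpM2l p0 H1; have le0 : (1 - p) * (f0 * g0) <= (1 - p) * h0.
  by apply: ler_wpM2l => //; rewrite subr_ge0.
apply: le_trans (lerD le1 le0); rewrite -subr_ge0.
have -> : p * (f1 * g1) + (1 - p) * (f0 * g0) -
   (p * f1 + (1 - p) * f0) * (p * g1 + (1 - p) * g0) =
   p * (1 - p) * ((f0 - f1) * (g0 - g1)) by ring.
by rewrite !mulr_ge0 ?subr_ge0.
Qed.

Definition up A := forall S U, S \subset U -> A S -> A U.

(** Complements of increasing events have decreasing indicators, so [harris_mean] applies one event
    at a time. *)
Lemma harris_seq (I : eqType) (r : seq I) D (E : I -> {set T} -> bool) :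
  (forall i, i \in r -> up (E i)) ->
  \prod_(i <- r) (1 - Pr D (E i)) <= 1 - Pr D (fun S => has (E^~ S) r).
Proof.
elim: r => [|i r IH] upE; rewrite ?big_nil ?big_cons.
  by rewrite -PrC /= PrE mean_cst.
have upr j : j \in r -> up (E j) by move=> jr; apply: upE; rewrite inE jr orbT.
have downN A : up A -> down (fun S => (~~ A S)%:R).
  by move=> uA S U /uA; case: (A S) => [/(_ isT)->|_] //=; case: (A U); rewrite ?ler01.
apply: le_trans (_ : (1 - Pr D (E i)) * (1 - Pr D (fun S => has (E^~ S) r)) <= _).
  by rewrite ler_wpM2l ?IH // -PrC Pr_ge0.
rewrite -!PrC !PrE.
rewrite [leRHS](_ : _ = mean D (fun S => (~~ E i S)%:R * (~~ has (E^~ S) r)%:R)).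
  apply: harris_mean; apply: downN; first by apply: upE; rewrite inE eqxx.
  move=> S U sSU /hasP[j jr EjS]; apply/hasP; exists j => //.
  exact: upr sSU EjS.
by apply: eq_bigr => S _ /=; rewrite negb_or; case: (E i S); rewrite ?mul0r ?mul1r.
Qed.

Lemma harris_exists (I : finType) (Q : pred I) D (E : I -> {set T} -> bool) :
  (forall i, Q i -> up (E i)) ->
  \prod_(i | Q i) (1 - Pr D (E i)) <= 1 - Pr D (fun S => [exists i, Q i && E i S]).
Proof.
move=> upE; rewrite -big_filter.
apply: le_trans (harris_seq D _) _ => [i|].
  by rewrite mem_filter => /andP[/upE].
rewrite lerB // Pr_le // => S _ /existsP[i /andP[Qi EiS]].
by apply/hasP; exists i => //; rewrite mem_filter Qi mem_index_enum.
Qed.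

(** Disjoint occurrence. Only [A] gets an explicit witness; for increasing [B] this amounts to a
    pair of disjoint witnesses, see [boxI]. *)
Definition box A B S := [exists U : {set T}, [&& U \subset S, A U & B (S :\: U)]].

Lemma boxI A B (S U V : {set T}) : up B ->
  U \subset S -> V \subset S -> [disjoint U & V] -> A U -> B V -> box A B S.
Proof.
move=> uB US VS dUV AU BV; apply/existsP; exists U; rewrite US AU /=.
by apply: uB BV; rewrite subsetD VS disjoint_sym.
Qed.

Lemma up_box A B : up B -> up (box A B).
Proof.
move=> uB S S' sSS' /existsP[U /and3P[US AU BU]]; apply/existsP; exists U.
by rewrite (subset_trans US sSS') AU (uB _ _ (setSD _ sSS') BU).
Qed.

(** The element [e] can serve only one of the two events, according to whether it lies in the
    witness of [A]. *)
Lemma box_setU1 e A B S : up A -> up B ->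
  box A B (e |: S) ->
  box (fun S => A (e |: S)) B S || box A (fun S => B (e |: S)) S.
Proof.
move=> uA uB /existsP[U /and3P[US AU BU]].
have subS : U :\ e \subset S by rewrite subDset.
have [eU|eU] := boolP (e \in U); apply/orP; [left|right]; apply/existsP.
  exists (U :\ e); rewrite subS setD1K // AU /=; apply: uB BU.
  by apply/subsetP => x; rewrite !inE; case: eqP => [->|]; rewrite ?eU.
have sUS : U \subset S by rewrite -(setU1K eU) subDset subUset sub1set setU11.
exists U; rewrite sUS AU /=.
by apply: uB BU; rewrite setDUl setSU // subsetDl.
Qed.

(* Condition on one element [e] and write [A1], [B1] for [A], [B] given [e].  Then
   [box A B] given [e] is contained in [X := box A1 B] or [Y := box A B1], with
   [P(X or Y) <= P(X) + P(Y) - P(box A B)]; for [p <= 1/2] the coefficient [1 - 2p]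
   of [P(box A B)] is nonnegative, and the slack is [p^2 (P(A1) - P(A)) (P(B1) - P(B))]. *)
Lemma bk D A B : p <= 1 / 2 -> up A -> up B -> Pr D (box A B) <= Pr D A * Pr D B.
Proof.
case/andP: p01 => p0 _ p2; elim/setU1_ind: D A B => [|e D eD IH] A B uA uB.
  rewrite !PrE !mean0; case: (boolP (box A B set0)) => [/existsP[U]|_]; last by rewrite mulr_ge0 ?ler0n.
  rewrite subset0 => /and3P[/eqP-> A0]; rewrite setD0 => B0.
  by rewrite A0 B0 mulr1.
rewrite !PrU1 //.
pose A1 S := A (e |: S); pose B1 S := B (e |: S).
have upU C : up C -> up (fun S => C (e |: S)) by move=> uC S U sSU; apply/uC/setUS.
have leU C : up C -> Pr D C <= Pr D (fun S => C (e |: S)).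
  by move=> uC; apply: Pr_le => S _; apply/uC/subsetUr.
have le1 : Pr D (fun S => box A B (e |: S)) <=
    Pr D (box A1 B) + Pr D (box A B1) - Pr D (box A B).
  rewrite lerBrDr !PrE /mean -!big_split /=; apply: ler_sum => S _.
  rewrite -!mulrDr; apply: ler_wpM2l; first exact: weight_ge0.
  have boxl : box A B S -> box A1 B S && box A B1 S.
    move=> /existsP[U /and3P[US AU BU]]; apply/andP; split; apply/existsP; exists U;
      rewrite US /=; apply/andP; split=> //.
      by apply: uA AU; apply: subsetUr.
    by apply: uB BU; apply: subsetUr.
  have : box A B (e |: S) -> box A1 B S || box A B1 S by exact: box_setU1.
  move: boxl;
  case: (box A B S); case: (box A1 B S); case: (box A B1 S);
    case: (box A B _) => //= h1 h2; try (by have := h1 isT); try (by have := h2 isT); lra.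
have := IH _ _ uA uB; have := IH _ _ (upU _ uA) uB; have := IH _ _ uA (upU _ uB).
rewrite -[fun S => A _]/A1 -[fun S => B _]/B1.
have := leU _ uA; have := leU _ uB; rewrite -[fun S => A _]/A1 -[fun S => B _]/B1.
set a0 := Pr D A; set b0 := Pr D B; set a1 := Pr D A1; set b1 := Pr D B1.
move: le1; set x := Pr D _; set x10 := Pr D _; set x01 := Pr D _; set x00 := Pr D _.
move=> lex leb lea H01 H10 H00.
have P1 : p * x <= p * (a1 * b0 + a0 * b1 - x00) by apply: ler_wpM2l => //; lra.
have P2 : (1 - 2 * p) * x00 <= (1 - 2 * p) * (a0 * b0).
  by apply: ler_wpM2l => //; lra.
have P3 : 0 <= p * p * ((a1 - a0) * (b1 - b0)) by rewrite !mulr_ge0 ?subr_ge0.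
by nra.
Qed.

Fixpoint bigbox (As : seq ({set T} -> bool)) : {set T} -> bool :=
  if As is A :: As' then box A (bigbox As') else fun=> true.

Lemma up_bigbox As : up (bigbox As).
Proof. by elim: As => [|A As IH] //=; apply: up_box. Qed.

Lemma bigbox_map (I : eqType) (r : seq I) (E : I -> {set T} -> bool) S
    (U : I -> {set T}) : uniq r -> (forall i, i \in r -> U i \subset S) ->
  {in r &, forall i j, i != j -> [disjoint U i & U j]} ->
  (forall i, i \in r -> E i (U i)) -> bigbox [seq E i | i <- r] S.
Proof.
elim: r S => //= i r IH S /andP[ir ur] US dU EU.
apply/existsP; exists (U i); rewrite US ?EU ?mem_head //=.
apply: IH => // [j jr|j k jr kr|j jr].
- rewrite subsetD US ?in_cons ?jr ?orbT //= dU ?mem_head ?in_cons ?jr ?orbT //.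
  by apply: contraNneq ir => <-.
- by apply: dU; rewrite in_cons ?jr ?kr orbT.
- by apply: EU; rewrite in_cons jr orbT.
Qed.

Lemma bk_bigbox (I : eqType) (r : seq I) D (E : I -> {set T} -> bool) :
  p <= 1 / 2 -> (forall i, i \in r -> up (E i)) ->
  Pr D (bigbox [seq E i | i <- r]) <= \prod_(i <- r) Pr D (E i).
Proof.
move=> p2; elim: r => [|i r IH] uE; rewrite ?big_nil ?big_cons /= ?Pr_le1 //.
apply: le_trans (bk _ _ _ _) _ => //; first by apply: uE; rewrite mem_head.
  exact: up_bigbox.
apply: ler_wpM2l; first exact: Pr_ge0.
by apply: IH => j jr; apply: uE; rewrite in_cons jr orbT.
Qed.

End RandomSubset.

(** * Cores *)

Section Cores.
Local Open Scope nat_scope.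
Variables (V : finType) (d : nat).
Implicit Types (s t T : {set V}) (K W : {set {set V}}).

Definition uniform K := forall s, s \in K -> #|s| = d.+1.

(** The empty family satisfies this; nonemptiness is a separate hypothesis. *)
Definition core K :=
  forall s y, s \in K -> y \in s -> exists s', [/\ s' \in K, s' != s & s :\ y \subset s'].

Lemma eq_uniform K s t : uniform K -> s \in K -> t \in K -> s \subset t -> s = t.
Proof. by move=> uK sK tK st; apply/eqP; rewrite eqEcard st !uK /=. Qed.

Lemma facet_add K s s' y z : uniform K -> s \in K -> s' \in K -> y \in s ->
  s :\ y \subset s' -> z \in s' -> z \notin s -> s' = (z |: s) :\ y.
Proof.
move=> uK sK s'K ys sub zs' zs; have yz : y != z by apply: contraNneq zs => <-.
apply/esym/eqP; rewrite eqEcard; apply/andP; split.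
  apply/subsetP => x; rewrite !inE => /andP[xy] /orP[/eqP->//|xs].
  by apply: (subsetP sub); rewrite !inE xy.
have := cardsD1 y (z |: s); rewrite !inE ys orbT cardsU1 zs (uK s) // (uK s') //; lia.
Qed.

Definition star v W := [set s in W | v \in s].

Section Star.
Variables (W : {set {set V}}) (v : V) (s : {set V}).
Hypotheses (uW : uniform W) (cW : core W) (sW : s \in W) (vs : v \in s).

(** The core property gives a simplex across each of the [d] facets [s :\ y] through [v]. These are
    pairwise distinct, since a simplex containing both [s :\ y] and [s :\ y'] contains [s]. *)
Lemma star_neighbours : exists f : V -> {set V},
  [/\ forall y, y \in s -> [/\ f y \in W, f y != s & s :\ y \subset f y],
      s |: f @: (s :\ v) \subset star v W & #|s |: f @: (s :\ v)| = d.+1].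
Proof.
have [f fP] : exists f : V -> {set V},
    forall y, y \in s -> [/\ f y \in W, f y != s & s :\ y \subset f y].
  apply: (fin_all_exists (P := fun y t => y \in s -> [/\ t \in W, t != s & s :\ y \subset t])).
  move=> y; have [ys|_] := boolP (y \in s); last by exists s.
  by have [t tP] := cW sW ys; exists t.
exists f; split=> //.
  apply/subsetP => t /setU1P[->|/imsetP[y /setD1P[yv ys] ->]]; rewrite inE ?sW //.
  have [-> _ sub] := fP _ ys; apply: (subsetP sub); by rewrite !inE eq_sym yv.
have fs : s \notin f @: (s :\ v).
  by apply/imsetP => -[y /setD1P[_ /fP[_ /eqP]]] + _ e; rewrite -e.
rewrite cardsU1 fs card_in_imset.
  by have := cardsD1 v s; rewrite vs uW //; lia.
move=> y y' /setD1P[_ ys] /setD1P[_ y's] e; apply/eqP; apply/negPn/negP => ne.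
have [fW /eqP ns sub] := fP _ ys; have [_ _ sub'] := fP _ y's; case: ns.
apply/esym/(eq_uniform uW) => //; apply/subsetP => x xs.
have [xy|xy] := eqVneq x y; last by apply: (subsetP sub); rewrite !inE xy.
by rewrite e; apply: (subsetP sub'); rewrite !inE xs xy ne.
Qed.

Lemma star_min : d < #|star v W|.
Proof. by have [f [_ /subset_leq_card le <-]] := star_neighbours. Qed.

Hypothesis d0 : 0 < d.

(* The link of a vertex of minimal degree is the boundary of a d-simplex. *)
Lemma star_boundary : #|star v W| = d.+1 ->
  exists T, [/\ #|T| = d.+2, v \in T & star v W = [set T :\ y | y in T :\ v]].
Proof.
move=> e; have [f [fP sub card]] := star_neighbours.
have {sub card e} starE : star v W = s |: f @: (s :\ v).
  by apply/esym/eqP; rewrite eqEcard sub card e leqnn.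
have [y0 y0s] : exists y, y \in s :\ v.
  apply/set0Pn; rewrite -card_gt0; have := cardsD1 v s; rewrite vs uW //; lia.
move: (y0s) => /setD1P[y0v y0s']; have [f0W f0s sub0] := fP _ y0s'.
have [z z0 zs] : exists2 z, z \in f y0 & z \notin s.
  apply/subsetPn; apply: contraNN f0s => fs; apply/eqP; exact: (eq_uniform uW f0W sW fs).
exists (z |: s).
have fE w : w \in s -> z \in f w -> f w = (z |: s) :\ w.
  by move=> ws zw; have [fW _ subw] := fP _ ws; exact: (facet_add uW sW fW ws subw zw zs).
(* All neighbours share the new vertex [z] of [f y0]. The facet [f y0 :\ y] contains [v] and [z], so
   the second simplex across it is some [f w = (z |: s) :\ w]; it differs from [f y0] and contains
   [f y0 :\ y], which forces [w = y]. *)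
have fz y : y \in s :\ v -> z \in f y.
  move=> ys; have [->//|yy0] := eqVneq y y0.
  have /setD1P[yv ys'] := ys.
  have yf : y \in f y0 by apply: (subsetP sub0); rewrite !inE yy0.
  have [s2 [s2W s2f sub2]] := cW f0W yf.
  have zy : z != y by apply: contraNneq zs => ->.
  have z2 : z \in s2 by apply: (subsetP sub2); rewrite !inE zy.
  have v2 : v \in s2.
    apply: (subsetP sub2); rewrite !inE eq_sym yv; apply: (subsetP sub0).
    by rewrite !inE eq_sym y0v.
  have : s2 \in star v W by rewrite inE s2W.
  rewrite starE => /setU1P[e|/imsetP[w ws e]]; first by rewrite -e z2 in zs.
  suff <- : w = y by rewrite -e.
  move: (ws) => /setD1P[wv ws']; have zw : z \in f w by rewrite -e.
  move: (s2f) sub2; rewrite e (fE _ ws' zw) (fE _ y0s' z0) => ww0 subw.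
  apply/eqP; apply: contraT => wy.
  have : w \in (z |: s) :\ w.
    apply: (subsetP subw); rewrite !inE ws' wy orbT andbT /=.
    by apply: contraNneq ww0 => ->.
  by rewrite !inE eqxx.
have zv : z != v by apply: contraNneq zs => ->.
split; first by rewrite cardsU1 zs uW.
  by rewrite !inE vs orbT.
rewrite starE; apply/setP => t; apply/setU1P/imsetP => [[->|/imsetP[y ys ->]]|].
- by exists z; [rewrite !inE eqxx zv | rewrite setU1K].
- have /setD1P[yv ys'] := ys.
  by exists y; [rewrite !inE yv ys' orbT | rewrite fE // fz].
- move=> [y]; rewrite !inE => /andP[yv] /orP[/eqP->|ys] ->; [left|right].
    by rewrite setU1K.
  have ys' : y \in s :\ v by rewrite !inE yv.
  by apply/imsetP; exists y => //; rewrite fE // fz.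
Qed.

End Star.

(** Double counting of incidences between vertices and simplices. *)
Lemma sum_star W : uniform W -> \sum_(v in cover W) #|star v W| = d.+1 * #|W|.
Proof.
move=> uW; rewrite (eq_bigr (fun v => \sum_(s in W) (v \in s))); last first.
  by move=> v _; rewrite -sum1_card big_mkcond [RHS]big_mkcond; apply: eq_bigr => s _;
     rewrite inE; case: (s \in W); case: (v \in s).
rewrite exchange_big /= (eq_bigr (fun=> d.+1)); last first.
  move=> s sW; rewrite -(uW _ sW) -sum1_card [LHS]big_mkcond [RHS]big_mkcond /=.
  apply: eq_bigr => v _; have [vs|_] := boolP (v \in s); last by case: ifP.
  by rewrite ifT //; apply/bigcupP; exists s.
by rewrite sum_nat_const mulnC.
Qed.

(** All degrees are at least [d + 1], so if the conclusion fails, double counting makes them all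
    equal to [d + 1]. The star of [v0] then consists of the facets through [v0] of some [T]. The
    star of another vertex [u] of [T] comes from a [T'] containing [T :\ a] and [T :\ b], hence
    [T' = T], which supplies the last facet [T :\ v0] of a forbidden boundary. *)
Lemma core_cover_lt W : 1 < d -> uniform W -> core W -> W != set0 ->
  (forall T, #|T| = d.+2 -> exists2 y, y \in T & T :\ y \notin W) ->
  #|cover W| < #|W|.
Proof.
move=> d1 uW cW /set0Pn[s0 s0W] noT.
have coverW v : v \in cover W -> exists2 s, s \in W & v \in s by move/bigcupP.
have le v : v \in cover W -> d < #|star v W|.
  by case/coverW => s sW vs; apply: (star_min uW cW sW vs).
rewrite ltnNge; apply/negP => leW.
have allE v : v \in cover W -> #|star v W| = d.+1.
  move=> vW; apply/eqP; rewrite eqn_leq le // andbT leqNgt; apply/negP => gt.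
  have : \sum_(v in cover W) d.+1 < \sum_(v in cover W) #|star v W|.
    rewrite (bigD1 v) //= [ltnRHS](bigD1 v) //= -addSn leq_add //.
    by apply: leq_sum => w /andP[/le].
  rewrite sum_star // sum_nat_const mulnC ltn_pmul2l //; lia.
have starT v : v \in cover W ->
    exists T, [/\ #|T| = d.+2, v \in T & star v W = [set T :\ y | y in T :\ v]].
  move=> vW; have [s sW vs] := coverW _ vW.
  by apply: (star_boundary uW cW sW vs) (allE _ vW); lia.
have [v0 v0s] : exists v, v \in s0 by apply/set0Pn; rewrite -card_gt0 uW.
have v0W : v0 \in cover W by apply/bigcupP; exists s0.
have [T [cT vT starE]] := starT _ v0W.
have facet y : y \in T -> y != v0 -> T :\ y \in W.
  move=> yT yv; suff : T :\ y \in star v0 W by rewrite inE => /andP[].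
  by rewrite starE; apply/imsetP; exists y; rewrite // !inE yv.
have [u uT] : exists u, u \in T :\ v0.
  by apply/set0Pn; rewrite -card_gt0; have := cardsD1 v0 T; rewrite vT cT; lia.
have [a aT] : exists a, a \in T :\ v0 :\ u.
  apply/set0Pn; rewrite -card_gt0; have := cardsD1 v0 T; have := cardsD1 u (T :\ v0).
  by rewrite vT cT uT; lia.
have [b bT] : exists b, b \in T :\ v0 :\ u :\ a.
  apply/set0Pn; rewrite -card_gt0; have := cardsD1 v0 T; have := cardsD1 u (T :\ v0).
  have := cardsD1 a (T :\ v0 :\ u).
  by rewrite vT cT uT aT; lia.
move: uT aT bT; rewrite !inE => /andP[uv uT] /and3P[au av aT] /and4P[ba bu bv bT].
have starm w : w \in T -> w != v0 -> w != u -> T :\ w \in star u W.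
  by move=> wT wv wu; rewrite inE facet //= !inE uT eq_sym wu.
have uW' : u \in cover W.
  by apply/bigcupP; exists (T :\ a); rewrite ?facet // !inE uT eq_sym au.
have [T' [cT' uT' starE']] := starT _ uW'.
have sub w : w \in T -> w != v0 -> w != u -> T :\ w \subset T'.
  by move=> wT wv wu; have := starm _ wT wv wu; rewrite starE' => /imsetP[y _ ->]; apply: subD1set.
have eT : T = T'.
  apply/eqP; rewrite eqEcard cT cT' leqnn andbT; apply/subsetP => x xT.
  have [xa|xa] := eqVneq x a.
    by apply: (subsetP (sub b bT bv bu)); rewrite !inE xT xa eq_sym ba.
  by apply: (subsetP (sub a aT av au)); rewrite !inE xT xa.
have [y yT] := noT _ cT; have [->|yv] := eqVneq y v0; last by rewrite facet.
suff : T :\ v0 \in star u W by rewrite inE => /andP[->].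
by rewrite starE' -eT; apply/imsetP; exists v0; rewrite // !inE eq_sym uv.
Qed.

End Cores.

(** * Trees growing out of a core *)

Section Trees.
Local Open Scope nat_scope.
Variables (V : finType) (d : nat).
Implicit Types (s t T : {set V}) (S K W : {set {set V}}).

(** Disjoint occurrence makes the simplices of the tree distinct, while vertices may repeat across
    it. The children of [t] are the facets of [x |: t] other than [t]. *)
Fixpoint tree (r : nat) t S : bool :=
  if r is r'.+1 then
    [exists x, (x \notin t) &&
      box (fun S => x |: t \in S)
          (bigbox [seq tree r' ((x |: t) :\ y) | y <- enum t]) S]
  else true.

Lemma up_tree r t : up (tree r t).
Proof.
case: r => [|r] // S S' sS /existsP[x /andP[xt bS]]; apply/existsP; exists x.
by rewrite xt; apply: up_box sS bS; apply: up_bigbox.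
Qed.

Definition facet W t := [exists w in W, exists y in w, t == w :\ y].

Lemma facetP W t :
  reflect (exists w y, [/\ w \in W, y \in w & t = w :\ y]) (facet W t).
Proof.
apply: (iffP exists_inP) => [[w wW /exists_inP[y yw /eqP->]]|[w [y [wW yw ->]]]].
  by exists w, y.
by exists w => //; apply/exists_inP; exists y.
Qed.

Lemma facet_cover W t : facet W t -> t \subset cover W.
Proof.
case/facetP => w [y [wW yw ->]]; apply: subset_trans (subD1set _ _) _.
exact: bigcup_sup.
Qed.

Lemma facet_setU1 s W y : y \in s -> facet (s |: W) (s :\ y).
Proof. by move=> ys; apply/facetP; exists s, y; rewrite setU11. Qed.

Lemma facetU1 s W t : facet W t -> facet (s |: W) t.
Proof.
by case/facetP => w [y [wW yw ->]]; apply/facetP; exists w, y; rewrite setU1r.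
Qed.

Lemma cover_setU1 s W : cover (s |: W) = s :|: cover W.
Proof.
apply/setP => v; apply/bigcupP/setUP => [[t /setU1P[->|tW] vt]|].
- by left.
- by right; apply/bigcupP; exists t.
- case=> [vs|/bigcupP[t tW vt]]; first by exists s; rewrite ?setU11.
  by exists t; rewrite ?setU1r.
Qed.

Variable K : {set {set V}}.
Hypothesis uK : uniform d K.

(* Every simplex met within [k] steps of a growth from [W] brings a new vertex. *)
Fixpoint tight (k : nat) W : bool :=
  if k is k'.+1 then
    [forall s in K :\: W, [exists t, facet W t && (t \subset s)] ==>
       ~~ (s \subset cover W) && tight k' (s |: W)]
  else true.

Lemma tightS k W s t : tight k.+1 W -> s \in K -> s \notin W -> facet W t ->
  t \subset s -> ~~ (s \subset cover W) /\ tight k (s |: W).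
Proof.
move=> /forall_inP tW sK sW fWt ts.
have /implyP : [exists t, facet W t && (t \subset s)] ==>
       ~~ (s \subset cover W) && tight k (s |: W) by apply: tW; rewrite inE sW.
by move=> /(_ _)/andP; apply; apply/existsP; exists t; rewrite fWt.
Qed.

Lemma tight_le k k' W : k <= k' -> tight k' W -> tight k W.
Proof.
elim: k k' W => // k IH [//|k'] W lek tW; apply/forall_inP => s.
rewrite inE => /andP[sW sK]; apply/implyP => /existsP[t /andP[fWt ts]].
by have [ns tW'] := tightS tW sK sW fWt ts; rewrite ns; apply: IH lek tW'.
Qed.

Lemma card_facet W t : W \subset K -> facet W t -> #|t| = d.
Proof.
move=> WK /facetP[w [y [wW yw ->]]].
by have := cardsD1 y w; rewrite yw uK ?(subsetP WK) //; lia.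
Qed.

Lemma facet_new_vertex W s t : W \subset K -> s \in K -> facet W t ->
  t \subset s -> exists2 x, x \notin t & s = x |: t.
Proof.
move=> WK sK fWt ts; have ct := card_facet WK fWt.
have /cards1P[x xE] : #|s :\: t| == 1.
  by have := cardsID t s; rewrite (uK sK) (setIidPr ts) ct; lia.
exists x; first by have := set11 x; rewrite -xE inE => /andP[].
by rewrite -xE -{1}(setID s t) (setIidPr ts) setUC.
Qed.

Lemma tight_new_vertex k W s t : W \subset K -> tight k.+1 W -> s \in K -> s \notin W ->
  facet W t -> t \subset s ->
  exists x, [/\ x \notin cover W, s = x |: t & tight k (s |: W)].
Proof.
move=> WK tW sK sW fWt ts; have [x _ sE] := facet_new_vertex WK sK fWt ts.
have [nsub t'] := tightS tW sK sW fWt ts.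
exists x; split=> //; apply: contra nsub => xW.
by rewrite sE subUset sub1set xW facet_cover.
Qed.

(** Follow a growth path up to a simplex without a new vertex: every step adds one simplex and at
    most one vertex, and the last adds no vertex. *)
Lemma not_tight k W : W \subset K -> ~~ tight k W ->
  exists W', [/\ W \subset W', W' \subset K, #|W'| <= #|W| + k &
                 #|cover W'| + #|W| < #|cover W| + #|W'|].
Proof.
elim: k W => [//|k IH] W WK; rewrite negb_forall_in => /exists_inP[s].
rewrite inE => /andP[sW sK]; rewrite negb_imply => /andP[/existsP[t /andP[fWt ts]]].
have WK' : s |: W \subset K by rewrite subUset sub1set sK.
have cW : #|s |: W| = #|W|.+1 by rewrite cardsU1 sW.
rewrite negb_and negbK => /orP[sub|/(IH _ WK')[W' [sW' sK' cW' lt]]].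
  exists (s |: W); rewrite subsetUr WK' cover_setU1 (setUidPr sub) cW.
  by split=> //; lia.
exists W'; split=> //; first exact: subset_trans (subsetUr _ _) sW'.
  by move: cW'; rewrite cW; lia.
have [x _ sE] := facet_new_vertex WK sK fWt ts.
have : #|cover (s |: W)| <= #|cover W|.+1.
  rewrite cover_setU1 sE -setUA (setUidPr (facet_cover fWt)) cardsU1.
  by case: (_ \notin _).
by move: lt; rewrite cW; lia.
Qed.

(** Start from one simplex, where [#|W| - #|cover W| = - d], and apply [not_tight] up to [j] times;
    each round costs at most [k] simplices and raises this difference. *)
Lemma tight_or_dense k j : K != set0 ->
  exists W, [/\ W != set0, W \subset K, #|W| <= 1 + j * k &
    tight k W \/ #|cover W| + j <= #|W| + d].
Proof.
move=> /set0Pn[s sK]; elim: j => [|j [W [W0 WK cW [tW|dW]]]].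
- exists [set s]; rewrite sub1set cards1; split=> //; last right.
    by apply/set0Pn; exists s; rewrite set11.
  by rewrite /cover big_set1 uK //; lia.
- by exists W; split=> //; [nia|left].
have [tW|ntW] := boolP (tight k W); first by exists W; split=> //; [nia|left].
have [W' [WW' W'K cW' lt]] := not_tight WK ntW.
exists W'; split=> //; [|nia|right; lia].
by apply: contraNneq W0 => W'0; move: WW'; rewrite W'0 subset0.
Qed.

Definition sparse L S := forall W, W \subset S -> #|W| <= L -> #|W| <= #|cover W|.

(** After [d + 1] rounds there would be fewer vertices than simplices, against sparsity. *)
Lemma exists_tight k L : K != set0 -> sparse L K -> 1 + d.+1 * k <= L ->
  exists W, [/\ W != set0, W \subset K, #|W| <= L & tight k W].
Proof.
move=> K0 spK leL; have [W [W0 WK cW [tW|dW]]] := tight_or_dense k d.+1 K0.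
  by exists W; split=> //; apply: leq_trans leL.
by have := spK W WK (leq_trans cW leL); lia.
Qed.

(* The simplices at the ends of growth paths of length at most [k] that start across
   the face [t] and avoid [W]; distinct starting faces give disjoint sets as long
   as [W] is tight, which makes the branches of a tree disjoint. *)
Fixpoint reach (k : nat) W t : {set {set V}} :=
  if k is k'.+1 then
    \bigcup_(s in [set s in K :\: W | t \subset s])
      (s |: \bigcup_(y in t) reach k' (s |: W) (s :\ y))
  else set0.

Lemma reachP k W t s :
  reflect (exists s1, [/\ s1 \in K, s1 \notin W, t \subset s1 &
      s = s1 \/ exists2 y, y \in t & s \in reach k (s1 |: W) (s1 :\ y)])
    (s \in reach k.+1 W t).
Proof.
apply: (iffP bigcupP) => [[s1]|[s1 [s1K s1W ts1 sP]]].
  rewrite !inE => /andP[/andP[s1W s1K] ts1] /orP[/eqP->|/bigcupP[y yt sR]];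
    exists s1; split=> //; [by left|by right; exists y].
exists s1; first by rewrite !inE s1W s1K.
apply/setU1P; case: sP => [->|[y yt sR]]; [by left|right].
by apply/bigcupP; exists y.
Qed.

Lemma reach_sub k W t s : s \in reach k W t -> s \in K /\ s \notin W.
Proof.
elim: k W t => [|k IH] W t; first by rewrite inE.
case/reachP => s1 [s1K s1W _ [->//|[y _ /IH[sK]]]].
by rewrite !inE negb_or => /andP[].
Qed.

(** A path from [t] cannot use a simplex that is not reached from [t], so forbidding [s1] loses
    nothing. *)
Lemma reach_avoid k W t s s1 : s \in reach k W t -> s1 \notin reach k W t ->
  s \in reach k (s1 |: W) t.
Proof.
elim: k W t => [|k IH] W t; first by rewrite inE.
case/reachP => s2 [s2K s2W ts2 sP] s1R; apply/reachP; exists s2.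
have ne : s2 != s1.
  by apply: contraNneq s1R => <-; apply/reachP; exists s2; split=> //; left.
split=> //; first by rewrite !inE negb_or ne.
case: sP => [->|[y yt sR]]; [by left|right; exists y => //].
rewrite setUCA; apply: IH => //; apply: contra s1R => s1R.
by apply/reachP; exists s2; split=> //; right; exists y.
Qed.

(** Let [x] be the new vertex of the first simplex [s1]. Beyond [s1], induction applies to a face
    [s1 :\ y] containing [x]: either [s] contains this face, so [x] and a later new vertex, or [s]
    has two later new vertices. *)
Lemma reach_new k W t s : W \subset K -> facet W t -> tight k W ->
  s \in reach k W t ->
  0 < #|s :\: cover W| /\ (t \subset s \/ 1 < #|s :\: cover W|).
Proof.
elim: k W t => [|k IH] W t WK fWt tW; first by rewrite inE.
case/reachP => s1 [s1K s1W ts1 sP].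
have [x [xW s1E tW1]] := tight_new_vertex WK tW s1K s1W fWt ts1.
case: sP => [->|[y yt sR]].
  split; last by left.
  by apply/card_gt0P; exists x; rewrite inE xW s1E setU11.
have WK1 : s1 |: W \subset K by rewrite subUset sub1set s1K.
have xt : x \notin t by apply: contra xW; apply/subsetP/facet_cover.
have fW1 : facet (s1 |: W) (s1 :\ y) by apply: facet_setU1; rewrite (subsetP ts1).
have [n1 n2] := IH _ _ WK1 fW1 tW1 sR.
have sub : s :\: cover (s1 |: W) \subset s :\: cover W.
  by apply: setDS; rewrite cover_setU1 subsetUr.
suff gt1 : 1 < #|s :\: cover W| by split; [apply: ltnW|right].
case: n2 => [sub1|n2]; last exact: leq_trans n2 (subset_leq_card sub).
have xs : x \in s.
  apply: (subsetP sub1); rewrite !inE s1E setU11 andbT.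
  by apply: contraNneq xt => ->.
apply: leq_trans (_ : #|x |: (s :\: cover (s1 |: W))| <= _).
  suff xn : x \notin s :\: cover (s1 |: W) by rewrite cardsU1 xn.
  by rewrite inE cover_setU1 s1E inE setU11.
by apply: subset_leq_card; rewrite subUset sub1set inE xW xs.
Qed.

(** The first simplex [s1] across [t] has a single new vertex [x], so by [reach_new] it could be
    reached from [t'] only if [t'] were contained in [s1], that is, [t' = t]. By [reach_avoid] the
    paths from [t'] may thus avoid [s1], and induction applies to [s1 :\ y], which contains [x], and
    [t'], which does not. *)
Lemma reach_disjoint a b W t t' s : W \subset K -> facet W t -> facet W t' ->
  t != t' -> tight (a + b) W -> s \in reach a W t -> s \notin reach b W t'.
Proof.
elim: a W t => [|a IH] W t WK ft ft' ne tW; first by rewrite inE.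
case/reachP => s1 [s1K s1W ts1 sP].
have [x [xW s1E tW1]] := tight_new_vertex WK tW s1K s1W ft ts1.
have xt : x \notin t by apply: contra xW; apply/subsetP/facet_cover.
have xt' : x \notin t' by apply: contra xW; apply/subsetP/facet_cover.
have s1R : s1 \notin reach b W t'.
  apply/negP => s1R.
  have [_ [sub|]] := reach_new WK ft' (tight_le (leq_addl _ _) tW) s1R.
    case/negP: ne; rewrite eq_sym eqEcard (card_facet WK ft) (card_facet WK ft') leqnn.
    rewrite andbT; apply/subsetP => v vt'; have := subsetP sub _ vt'.
    by rewrite s1E !inE => /orP[/eqP vx|//]; rewrite -vx vt' in xt'.
  rewrite ltnNge; case/negP; rewrite -(cards1 x); apply: subset_leq_card.
  apply/subsetP => v; rewrite !inE s1E !inE => /andP[vW /orP[//|vt]].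
  by rewrite (subsetP (facet_cover ft)) in vW.
case: sP => [->//|[y yt sR]]; apply/negP => sR'.
have sR1 := reach_avoid sR' s1R; move: sR1; apply/negP.
have WK1 : s1 |: W \subset K by rewrite subUset sub1set s1K.
apply: (IH _ (s1 :\ y)) => //.
- by apply: facet_setU1; rewrite (subsetP ts1).
- exact: facetU1.
- apply: contraNneq xt' => <-; rewrite !inE s1E setU11 andbT.
  by apply: contraNneq xt => ->.
Qed.

(** The sets [reach] are the witnesses of disjoint occurrence. Comparing two branches of depth [r]
    accounts for the order [r + r] of tightness. Each branch starts by the core property, and its
    first simplex [s2] is not in [W] because it contains the new vertex [x]. *)
Lemma tree_reach r W s t : core K -> W \subset K -> tight (r + r) W ->
  s \in K -> s \notin W -> facet W t -> t \subset s -> tree r t (reach r W t).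
Proof.
move=> cK; elim: r W s t => // r IH W s t WK; rewrite addSn addnS => tW sK sW fWt ts.
have [x [xW sE tW1]] := tight_new_vertex WK tW sK sW fWt ts.
have xt : x \notin t by apply: contra xW; apply/subsetP/facet_cover.
have WK1 : s |: W \subset K by rewrite subUset sub1set sK.
have tW2 : tight (r + r) (s |: W) by apply: tight_le tW1.
have yx y : y \in t -> x \in s :\ y.
  by move=> yt; rewrite !inE sE setU11 andbT; apply: contraNneq xt => ->.
have fW1 y : y \in t -> facet (s |: W) (s :\ y).
  by move=> yt; apply: facet_setU1; rewrite (subsetP ts).
apply/existsP; exists x; rewrite xt -sE /=.
apply: (boxI (U := [set s]) (V := \bigcup_(y in t) reach r (s |: W) (s :\ y))).
- exact: up_bigbox.
- by rewrite sub1set; apply/reachP; exists s; split=> //; left.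
- apply/bigcupsP => y yt; apply/subsetP => s' s'R; apply/reachP.
  by exists s; split=> //; right; exists y.
- rewrite disjoints1; apply/bigcupP => -[y _ /reach_sub[_]].
  by rewrite setU11.
- by rewrite set11.
apply: (bigbox_map (U := fun y => reach r (s |: W) (s :\ y))); first exact: enum_uniq.
- by move=> y; rewrite mem_enum => yt; apply: (bigcup_sup y).
- move=> y y'; rewrite !mem_enum => yt y't ne; apply/pred0P => s' /=.
  apply/negP => /andP[sR]; apply/negP; apply: (reach_disjoint WK1 _ _ _ tW2 sR); rewrite ?fW1 //.
  apply: contraNneq ne => e; have : y \notin s :\ y by rewrite !inE eqxx.
  by rewrite e !inE (subsetP ts _ yt) andbT negbK.
- move=> y; rewrite mem_enum => yt.
  have [s2 [s2K s2s sub]] := cK s y sK (subsetP ts _ yt).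
  apply: (IH _ s2) => //; last exact: fW1.
  rewrite !inE negb_or s2s; apply: contra xW => s2W; apply/bigcupP; exists s2 => //.
  by apply: (subsetP sub); apply: yx.
Qed.

(** If no simplex of [K] outside the tight set [W] meets [W] in a facet, then [W] is itself a core,
    and [core_cover_lt] contradicts sparsity. Otherwise a tree grows across such a facet. *)
Lemma core_tree r L : 1 < d -> core K -> K != set0 ->
  (forall T, #|T| = d.+2 -> exists2 y, y \in T & T :\ y \notin K) ->
  sparse L K -> 1 + d.+1 * (r + r) <= L ->
  exists2 t : {set V}, #|t| = d & tree r t K.
Proof.
move=> d1 cK K0 noT spK leL; have [W [W0 WK cW tW]] := exists_tight K0 spK leL.
have [/exists_inP[s sP /existsP[t /andP[fWt ts]]]|none] :=
  boolP [exists s in K :\: W, [exists t, facet W t && (t \subset s)]].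
  move: sP; rewrite inE => /andP[sW sK]; exists t; first exact: card_facet fWt.
  apply: up_tree (tree_reach cK WK tW sK sW fWt ts).
  by apply/subsetP => s' /reach_sub[].
have uW : uniform d W by move=> s sW; rewrite uK // (subsetP WK).
have coreW : core W.
  move=> s y sW ys; have [s' [s'K s's sub]] := cK s y (subsetP WK _ sW) ys.
  exists s'; split=> //; apply: contraNT none => s'W; apply/exists_inP; exists s'.
    by rewrite inE s'W.
  by apply/existsP; exists (s :\ y); rewrite sub andbT; apply/facetP; exists s, y.
have noTW T : #|T| = d.+2 -> exists2 y, y \in T & T :\ y \notin W.
  by move=> /noT[y yT yK]; exists y => //; apply: contra yK; apply: (subsetP WK).
by have := core_cover_lt d1 uW coreW W0 noTW; rewrite ltnNge spK.
Qed.

End Trees.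

(** * First-moment bounds *)

Section Counting.
Local Open Scope nat_scope.
Variable V : finType.

Lemma bin_le_exp a b : 'C(a, b) <= a ^ b.
Proof.
apply: leq_trans (_ : a ^_ b <= _); first by rewrite -bin_ffact leq_pmulr ?fact_gt0.
elim: b a => // b IH a; rewrite ffactnS expnS leq_mul //.
apply: leq_trans (IH _) _; case: b {IH} => // b.
by rewrite leq_exp2r // leq_pred.
Qed.

Lemma card_lt m : 0 < #|V| -> #|[set U : {set V} | #|U| < m]| <= m * #|V| ^ m.-1.
Proof.
move=> V0; elim: m => [|m IH]; first by rewrite leqn0 cards_eq0; apply/eqP/setP => U; rewrite !inE.
have -> : [set U : {set V} | #|U| < m.+1] =
    [set U : {set V} | #|U| < m] :|: [set U : {set V} | #|U| == m].
  by apply/setP => U; rewrite !inE ltnS leq_eqVlt orbC.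
apply: leq_trans (leq_card_setU _ _) _; rewrite card_draws mulSn addnC /=.
rewrite leq_add ?bin_le_exp //; apply: leq_trans IH _.
by rewrite leq_mul2l leq_pexp2l ?leq_pred ?orbT.
Qed.

(** Choose the cover [U] first, then [m] members of its power set, which has at most [2 ^ m]
    elements. *)
Lemma card_dense m : 0 < #|V| ->
  #|[set W : {set {set V}} | (#|W| == m) && (#|cover W| < m)]| <=
    m * #|V| ^ m.-1 * 2 ^ (m * m).
Proof.
move=> V0; set A := [set W | _].
have le : #|A| <= \sum_(U : {set V} | #|U| < m)
    #|[set W : {set {set V}} | (W \subset powerset U) && (#|W| == m)]|.
  rewrite -sum1_card (partition_big (fun W => cover W) (fun U : {set V} => #|U| < m)) /=.
    apply: leq_sum => U _; rewrite sum1dep_card; apply: subset_leq_card.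
    apply/subsetP => W; rewrite !inE => /andP[/andP[-> _] /eqP<-]; rewrite andbT.
    by apply/subsetP => s sW; rewrite inE; apply: bigcup_sup.
  by move=> W; rewrite inE => /andP[].
apply: leq_trans le _.
apply: leq_trans (_ : \sum_(U : {set V} | #|U| < m) 2 ^ (m * m) <= _).
  apply: leq_sum => U ltU; rewrite cards_draws card_powerset.
  apply: leq_trans (bin_le_exp _ _) _; rewrite -expnM leq_exp2l //.
  by rewrite leq_mul2r ltnW ?orbT.
rewrite sum_nat_cond_const leq_mul2r; apply/orP; right.
by have := card_lt m V0; rewrite cardsE.
Qed.

End Counting.

(** * Failure of collapsibility yields a core, hence a dense family or a deep tree *)

Section Collapse.
Local Open Scope nat_scope.
Variables (n d : nat).
Implicit Types (S K : {set {set 'I_n}}).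

Lemma dfaces_uniform S : S \subset dfaces n d -> uniform d S.
Proof. by move=> sub s /(subsetP sub); rewrite inE => /eqP. Qed.

Lemma Rstep_sub S : Rstep d S \subset S.
Proof. by apply/subsetP => s; rewrite inE => /andP[]. Qed.

Lemma Rstep_fix_core S : uniform d S -> Rstep d S = S -> core S.
Proof.
move=> uS fixS s y sS ys; move: (sS); rewrite -{1}fixS inE sS /=.
have ct : #|s :\ y| = d by have := cardsD1 y s; rewrite ys uS //; lia.
move=> nofree; have /existsP[s' /and3P[s'S ne sub]] :
    [exists s', [&& s' \in S, s' != s & s :\ y \subset s']]; last by exists s'.
apply: contraR nofree => none; apply/existsP; exists (s :\ y).
rewrite ct eqxx subD1set /free_face /=; apply/cards1P; exists s.
apply/setP => s'; rewrite !inE; apply/andP/eqP => [[s'S sub]|->].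
  by apply: contraNeq none => ne; apply/existsP; exists s'; rewrite s'S ne.
by rewrite sS subD1set.
Qed.

(** Each step either shrinks the complex or fixes it; a fixed complex has no free face and is
    therefore a core. *)
Lemma not_collapsible_core S : S \subset dfaces n d -> ~ d_collapsible d S ->
  exists K, [/\ K \subset S, K != set0 & core K].
Proof.
have [m] := ubnP #|S|; elim: m S => // m IH S leS SD ncS.
have [fixS|ne] := eqVneq (Rstep d S) S.
  exists S; split=> //; last exact: Rstep_fix_core (dfaces_uniform SD) fixS.
  by apply/eqP => S0; apply: ncS; exists 0.
have pS : Rstep d S \proper S by rewrite properEneq ne Rstep_sub.
have [||[k e]|K [KS K0 cK]] := IH (Rstep d S).
- by have := proper_card pS; lia.
- exact: subset_trans (Rstep_sub S) SD.
- by apply: ncS; exists k.+1; rewrite iterSr.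
by exists K; split=> //; apply: subset_trans KS (Rstep_sub S).
Qed.

Lemma in_F_facet S (T : {set 'I_n}) : in_F d S -> #|T| = d.+2 ->
  exists2 y, y \in T & T :\ y \notin S.
Proof.
move=> /existsPn/(_ T) + cT; rewrite cT eqxx /= => /forallPn[s].
rewrite negb_imply => /andP[/andP[sT /eqP cs] sS].
have /cards1P[y yE] : #|T :\: s| == 1.
  by have := cardsID s T; rewrite (setIidPr sT) cT cs; lia.
have : y \in T :\: s by rewrite yE set11.
rewrite inE => /andP[ys yT]; exists y => //.
by rewrite -yE setDDr setDv set0U (setIidPr sT).
Qed.

Lemma collapse_dichotomy S r L : 1 < d -> S \subset dfaces n d ->
  in_F d S -> ~ d_collapsible d S -> 1 + d.+1 * (r + r) <= L ->
  [exists W : {set {set 'I_n}}, [&& W \subset dfaces n d, #|W| <= L & #|cover W| < #|W|]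
     && (W \subset S)]
  || [exists t : {set 'I_n}, (#|t| == d) && tree r t S].
Proof.
move=> d1 SD FS ncS leL; have [K [KS K0 cK]] := not_collapsible_core SD ncS.
case: (boolP [exists W, _]) => //= none.
have uK := dfaces_uniform (subset_trans KS SD).
have [||t ct tK] := core_tree uK d1 cK K0 _ _ leL.
- move=> T /(in_F_facet FS)[y yT yS]; exists y => //.
  by apply: contra yS; apply: (subsetP KS).
- move=> W WK leW; rewrite leqNgt; apply: contra none => lt; apply/existsP; exists W.
  by rewrite leW lt (subset_trans WK KS) (subset_trans (subset_trans WK KS) SD).
by apply/existsP; exists t; rewrite ct eqxx; apply: up_tree tK.
Qed.

End Collapse.

(** * Probabilities of dense families, of trees and of the family [in_F] *)

Section RandomComplex.
Variables (R : realFieldType) (n d : nat) (p : R).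
Hypothesis p01 : 0 <= p <= 1.

Lemma Pr_dense (D : {set {set 'I_n}}) L : (0 < n)%N ->
  Pr p D (fun S => [exists W : {set {set 'I_n}},
     [&& W \subset D, (#|W| <= L)%N & (#|cover W| < #|W|)%N] && (W \subset S)]) <=
  \sum_(m < L.+1) (m * n ^ m.-1 * 2 ^ (m * m))%:R * p ^+ m.
Proof.
case/andP: p01 => p0 _ n0.
pose Q (W : {set {set 'I_n}}) := [&& W \subset D, (#|W| <= L)%N & (#|cover W| < #|W|)%N].
apply: le_trans (Pr_exists p01 Q D (fun W S => W \subset S)) _.
have -> : \sum_(W | Q W) Pr p D (fun S => W \subset S) = \sum_(W | Q W) p ^+ #|W|.
  by apply: eq_bigr => W /and3P[WD _ _]; apply: Pr_supset.
(* Group the union bound by size; [inord] does not truncate because [#|W| <= L]. *)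
rewrite (partition_big (fun W : {set {set 'I_n}} => inord #|W| : 'I_L.+1) xpredT) //=.
apply: ler_sum => m _; have Vn : (0 < #|'I_n|)%N by rewrite card_ord.
apply: le_trans (_ : #|[set W : {set {set 'I_n}} | (#|W| == m) && (#|cover W| < m)%N]|%:R
    * p ^+ m <= _); last first.
  rewrite ler_wpM2r ?exprn_ge0 // ler_nat; have := card_dense m Vn.
  by rewrite card_ord.
rewrite mulr_natl -sumr_const [leLHS]big_mkcond [leRHS]big_mkcond /=.
apply: ler_sum => W _; rewrite inE.
case: ifP => [/andP[/and3P[_ leL lt] /eqP e]|_]; last by case: ifP; rewrite ?exprn_ge0.
have {}e : #|W| = m by rewrite -e inordK // ltnS.
by rewrite -{2}e lt e eqxx.
Qed.

(** For a fixed new vertex, [bk] bounds the simplex and its [d] branches by [p * a r ^+ d]; Harris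
    combines at most [n] choices of that vertex. The function [g] leaves room to replace
    [1 - (1 - p u)^n] by its exponential bound. *)
Lemma Pr_tree (g : R -> R) (a : nat -> R) : p <= 1 / 2 -> a 0%N = 1 ->
  (forall r, 0 <= a r <= 1) -> (forall r, a r.+1 = g (a r ^+ d)) ->
  (forall u : R, 0 <= u <= 1 -> 1 - (1 - p * u) ^+ n <= g u) ->
  forall r (t : {set 'I_n}), #|t| = d -> Pr p (dfaces n d) (tree r t) <= a r.
Proof.
case/andP: p01 => p0 p1 p2 a0 a01 aS leg; elim=> [|r IH] t ct.
  by rewrite a0; apply: Pr_le1.
have u01 : 0 <= a r ^+ d <= 1.
  by case/andP: (a01 r) => ar0 ar1; rewrite exprn_ge0 ?exprn_ile1.
have pu01 : 0 <= 1 - p * a r ^+ d <= 1.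
  case/andP: u01 => u0 u1; rewrite subr_ge0 lerBlDr lerDl mulr_ge0 // andbT.
  by apply: mulr_ile1.
rewrite aS; apply: le_trans (leg _ u01); rewrite lerBrDr -lerBrDl.
pose As x := [seq tree r ((x |: t) :\ y) | y <- enum t].
pose E x := box (fun S : {set {set 'I_n}} => x |: t \in S) (bigbox (As x)).
apply: le_trans (harris_exists p01 (Q := fun x => x \notin t) (dfaces n d) (E := E) _).
  2: by move=> x _; apply: up_box; apply: up_bigbox.
apply: le_trans (_ : \prod_(x | x \notin t) (1 - p * a r ^+ d) <= _).
  rewrite prodr_const; case/andP: pu01 => pu0 pu1.
  by apply: ler_wiXn2l => //; apply: leq_trans (max_card _) _; rewrite card_ord.
apply: ler_prod => x xt; case/andP: pu01 => -> _ /=; rewrite lerB //.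
have cx : #|x |: t| = d.+1 by rewrite cardsU1 xt ct.
have upx : up (fun S : {set {set 'I_n}} => x |: t \in S) by move=> S U /subsetP; apply.
apply: le_trans (bk p01 (dfaces n d) p2 upx (@up_bigbox _ (As x))) _.
apply: ler_pM; rewrite ?Pr_ge0 //.
  have -> : Pr p (dfaces n d) (fun S => x |: t \in S) =
      Pr p (dfaces n d) (fun S => [set x |: t] \subset S).
    by apply: Pr_eq => S _; rewrite sub1set.
  by rewrite Pr_supset ?sub1set ?inE ?cx // cards1.
apply: le_trans (bk_bigbox p01 _ p2 _) _; first by move=> y _; apply: up_tree.
rewrite big_enum /= -{2}ct -prodr_const; apply: ler_prod => y yt.
rewrite Pr_ge0 //= IH //; have := cardsD1 y (x |: t).
by rewrite !inE yt orbT cx => -[].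
Qed.

(** Harris over at most [n ^ d.+2] sets [T]: each boundary consists of [d + 2] simplices. *)
Lemma Pr_in_F : (1 - p ^+ d.+2) ^+ (n ^ d.+2) <= Pr p (dfaces n d) (@in_F n d).
Proof.
have q01 : 0 <= 1 - p ^+ d.+2 <= 1.
  by case/andP: p01 => p0 p1; rewrite subr_ge0 exprn_ile1 // lerBlDr lerDl exprn_ge0.
pose F (T : {set 'I_n}) := [set s : {set 'I_n} | (s \subset T) && (#|s| == d.+1)].
have eqF S : in_F d S =
    ~~ [exists T : {set 'I_n}, (#|T| == d.+2) && (F T \subset S)].
  congr (~~ _); apply: eq_existsb => T; congr (_ && _).
  apply/forallP/subsetP => [h s|h s]; first by rewrite inE; apply/implyP.
  by apply/implyP => sF; apply: h; rewrite inE.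
have -> : Pr p (dfaces n d) (@in_F n d) = Pr p (dfaces n d)
    (fun S => ~~ [exists T : {set 'I_n}, (#|T| == d.+2) && (F T \subset S)]).
  by apply: Pr_eq => S _; apply: eqF.
rewrite PrC.
have upF (T : {set 'I_n}) : #|T| == d.+2 -> up (fun S => F T \subset S).
  by move=> _ S U SU /subset_trans; apply.
apply: le_trans (harris_exists p01 (dfaces n d) upF).
rewrite (eq_bigr (fun=> 1 - p ^+ d.+2)) => [|T /eqP cT]; last first.
  rewrite Pr_supset; first by rewrite cards_draws cT binSn.
  by apply/subsetP => s; rewrite !inE => /andP[].
rewrite prodr_const; case/andP: q01 => q0 q1; apply: ler_wiXn2l => //.
by have := card_draws 'I_n d.+2; rewrite cardsE card_ord => ->; apply: bin_le_exp.
Qed.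

End RandomComplex.

Local Open Scope classical_set_scope.

(** * The survival recursion and the conclusion *)

Section CollapseSequence.
Variables (R : realType) (d : nat) (c : R).

(** The survival probability to depth [r] when the number of simplices grown across a face is
    Poisson with mean [c] and all [d] branches of one of them must survive. With [t = 1 - x] its
    fixed points solve the equation defining [gamma_d]. *)
Definition collapse_seq (r : nat) : R :=
  iter r (fun t => 1 - expR (- (c * t ^+ d))) 1.

Local Notation a := collapse_seq.

(** If this fails at [t], then [x = 1 - t] is positive and solves the equation for the parameter
    [- ln (1 - t) / t ^+ d], which is at most [c], against [c < gamma_d]. *)
Lemma lt_gamma_d t : (0 < d)%N -> c < gamma_d R d -> 0 < t <= 1 ->
  1 - expR (- (c * t ^+ d)) < t.
Proof.
move=> d0 cg /andP[t0 t1]; rewrite ltNge; apply/negP => le_t.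
have x0 : 0 < 1 - t by apply: lt_le_trans (expR_gt0 (- (c * t ^+ d))) _; lra.
have td : 0 < t ^+ d by rewrite exprn_gt0.
have lnx : ln (1 - t) <= 0 by rewrite ln_le0; lra.
suff : gamma_d R d <= - ln (1 - t) / t ^+ d.
  rewrite ler_pdivlMr // => le_g.
  have : - (c * t ^+ d) <= ln (1 - t).
    rewrite -ler_expR lnK ?posrE //; lra.
  have : c * t ^+ d < gamma_d R d * t ^+ d by rewrite ltr_pM2r.
  lra.
apply: ge_inf; first by exists 0 => g [].
split; first by rewrite divr_ge0 ?oppr_ge0 // ltW.
exists (1 - t); split; first lra.
have -> : 1 - (1 - t) = t by ring.
by rewrite divfK ?gt_eqF // opprK lnK // posrE.
Qed.

Hypothesis c0 : 0 <= c.

Lemma collapse_seqS r : a r.+1 = 1 - expR (- (c * a r ^+ d)).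
Proof. by []. Qed.

Lemma collapse_seq01 r : 0 <= a r <= 1.
Proof.
case: r => [|r]; first by rewrite /a /= ler01 lexx.
have : 0 <= a r.
  elim: r => [|r IH]; first exact: ler01.
  by rewrite collapse_seqS subr_ge0 -expR0 ler_expR oppr_le0 mulr_ge0 ?exprn_ge0.
move=> ar; rewrite collapse_seqS; apply/andP; split.
  by rewrite subr_ge0 -expR0 ler_expR oppr_le0 mulr_ge0 ?exprn_ge0.
by rewrite lerBlDr lerDl expR_ge0.
Qed.

Lemma collapse_seqS_le r : a r.+1 <= c * a r ^+ d.
Proof. by rewrite collapse_seqS; have := expR_ge1Dx (- (c * a r ^+ d)); lra. Qed.

(** Otherwise the sequence decreases to a fixed point in [[e, 1]], which [lt_gamma_d] excludes. *)
Lemma collapse_seq_small e : (0 < d)%N -> c < gamma_d R d -> 0 < e ->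
  exists r, a r <= e.
Proof.
move=> d0 cg e0; apply: contrapT => /forallNP nex.
have ae r : e < a r by rewrite ltNge; apply/negP.
have a01 r : 0 < a r <= 1.
  by case/andP: (collapse_seq01 r) => _ ->; rewrite (lt_trans e0).
have dec r : a r.+1 <= a r by rewrite collapse_seqS ltW // lt_gamma_d.
have cva : a @ \oo --> lim (a @ \oo).
  apply: nonincreasing_is_cvgn; first exact/nonincreasing_seqP.
  by exists 0 => _ [r _ <-]; case/andP: (collapse_seq01 r).
set l := lim (a @ \oo) in cva.
have le_l : e <= l by apply: limr_ge => //; near=> r; apply/ltW.
have l1 : l <= 1.
  by apply: limr_le => //; near=> r; case/andP: (a01 r).
have cvS : a r.+1 @[r --> \oo] --> l by rewrite cvg_shiftS.
have cvX : c * a r ^+ d @[r --> \oo] --> c * l ^+ d.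
  apply: (@cvgM _ _ _ _ (fun=> c)); first exact: cvg_cst.
  exact: (continuous_cvg _ (@exprn_continuous R d l) cva).
have cvg' : a r.+1 @[r --> \oo] --> 1 - expR (- (c * l ^+ d)).
  apply: cvgB; first exact: cvg_cst.
  apply: (continuous_cvg _ (@continuous_expR R _)).
  exact: cvgN cvX.
have : l = 1 - expR (- (c * l ^+ d)) by apply: cvg_unique cvS cvg'.
have := lt_gamma_d d0 cg (t := l); lra.
Unshelve. all: by end_near.
Qed.

(** Since [d >= 2], the rescaled sequence [(c + 1) a] is at most squared at each step; [r0] is
    chosen to bring it down to [1 / 2]. *)
Lemma collapse_seq_double_exp : (1 < d)%N -> c < gamma_d R d ->
  exists r0, forall j, a (r0 + j)%N <= (1 / 2) ^+ (2 ^ j).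
Proof.
move=> d1 cg; have c0' := c0; have C0 : 0 < c + 1 by lra.
have [|r0 le_r0] := collapse_seq_small (e := 1 / (2 * (c + 1))) (ltnW d1) cg.
  by rewrite divr_gt0 // mulr_gt0.
exists r0 => j; apply: le_trans (_ : (c + 1) * a (r0 + j)%N <= _).
  by case/andP: (collapse_seq01 (r0 + j)) => a0 _; rewrite ler_peMl //; lra.
elim: j => [|j IH].
  rewrite addn0 expn0 expr1 mulrC; move: le_r0; rewrite ler_pdivlMr ?mulr_gt0 //; lra.
rewrite addnS expnSr exprM; case/andP: (collapse_seq01 (r0 + j)) => a0 a1.
apply: le_trans (_ : ((c + 1) * a (r0 + j)%N) ^+ 2 <= _); last first.
  by rewrite lerXn2r ?nnegrE // ?mulr_ge0 ?exprn_ge0 //; lra.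
apply: le_trans (_ : (c + 1) * (c * a (r0 + j)%N ^+ d) <= _).
  by rewrite ler_wpM2l ?collapse_seqS_le // ltW.
rewrite exprMn expr2 -mulrA ler_pM2l //; apply: ler_pM => //.
- by rewrite exprn_ge0.
- by rewrite lerDl.
- exact: ler_wiXn2l.
Qed.

End CollapseSequence.

(** * Integer estimates for depths of order log log n *)

Section Asymptotics.
Local Open Scope nat_scope.

(** With [2 ^ (2 ^ k) <= n], this makes a first moment [2 ^ (D (k + 1)^2) / n] at most [2 ^ - k]. *)
Lemma sqr_le_exp2 D : exists k0, forall k, k0 <= k -> D * k.+1 ^ 2 + k <= 2 ^ k.
Proof.
exists (16 + 4 * D.+1) => k lek.
have pow4 j : 16 <= j -> j ^ 4 <= 2 ^ j.
  elim: j => // j IH; rewrite leq_eqVlt => /orP[/eqP<-//|]; rewrite ltnS => lej.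
  apply: leq_trans (_ : 2 * j ^ 4 <= _); last by rewrite (expnS 2 j) leq_mul2l IH.
  have -> : j.+1 ^ 4 = j ^ 4 + (4 * j ^ 3 + 6 * j ^ 2 + 4 * j + 1) by ring.
  have j2 : j ^ 2 * 16 <= j ^ 3 by rewrite (expnSr j 2) leq_mul2l lej orbT.
  have j3 : j ^ 3 * 16 <= j ^ 4 by rewrite (expnSr j 3) leq_mul2l lej orbT.
  have j1 : j * 16 <= j ^ 2 by rewrite (expnSr j 1) leq_mul2l lej orbT.
  by lia.
apply: leq_trans (pow4 k _); last lia.
have k2 : k.+1 ^ 2 <= 4 * k ^ 2 by have := leq_sqr k.+1 (2 * k); rewrite expnMn => ->; lia.
have kk : k <= k ^ 2 by rewrite -{1}(expn1 k) leq_pexp2l //; lia.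
apply: leq_trans (_ : 4 * D.+1 * k ^ 2 <= _).
  have := leq_mul (leqnn D) k2; lia.
have -> : k ^ 4 = k ^ 2 * k ^ 2 by rewrite -expnD.
by rewrite leq_mul2r; apply/orP; right; lia.
Qed.

Lemma affine_le_mulS a e m k :
  1 + m * ((a + (k + e)) + (a + (k + e))) <= (1 + m * 2 * (a + e.+1)) * k.+1.
Proof. by nia. Qed.

(** For [m = d]: the extra [2 d + 1] levels of the tree outweigh the choices of the root. *)
Lemma exp2_gap m k : 2 ^ k.+1 * m + k <= 2 ^ (k + m.*2.+1).
Proof.
have := ltn_expl m.*2.+1 (isT : 1 < 2); have := ltn_expl k (isT : 1 < 2).
rewrite expnD (expnS 2 k) => ltk ltm; apply: leq_trans (leq_mul (leqnn _) ltm).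
by rewrite -mul2n; nia.
Qed.

Lemma double_trunc_log n : 2 <= n ->
  let k := trunc_log 2 (trunc_log 2 n) in 2 ^ (2 ^ k) <= n <= 2 ^ (2 ^ k.+1).
Proof.
move=> n2 /=; set l := trunc_log 2 n; set k := trunc_log 2 l.
have l0 : 0 < l by apply: trunc_log_max.
have kl : 2 ^ k <= l by apply: trunc_logP.
have lk : l < 2 ^ k.+1 by apply: trunc_log_ltn.
apply/andP; split.
  apply: leq_trans (_ : 2 ^ l <= _); first by rewrite leq_exp2l.
  by apply: trunc_logP => //; lia.
apply/ltnW/(leq_trans (trunc_log_ltn n (isT : 1 < 2))).
by rewrite leq_exp2l.
Qed.

End Asymptotics.

(** * Comparison of powers with exponentials, and the first-moment sum *)

Section Bounds.
Variable R : realType.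

(** Take [n]-th roots and use [1 + y <= expR y] with [y = c' u / n]: the gap [c' - c] absorbs the
    second-order term of [(1 - c u / n) (1 + c' u / n)]. *)
Lemma expR_le_pow (c c' u : R) (n : nat) : 0 <= c < c' -> 0 <= u <= 1 -> (0 < n)%N ->
  c <= n%:R -> c * c' <= (c' - c) * n%:R ->
  expR (- (c' * u)) <= (1 - c / n%:R * u) ^+ n.
Proof.
move=> /andP[c0 cc'] /andP[u0 u1] n0 cn le_n.
have nR : 0 < n%:R :> R by rewrite ltr0n.
have -> : - (c' * u) = n%:R * (- (c' * u / n%:R)) by field; rewrite gt_eqF.
rewrite expRM_natl; have c'0 : 0 < c' by apply: le_lt_trans cc'.
have y0 : 0 <= c' * u / n%:R by rewrite !mulr_ge0 ?invr_ge0 // ltW.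
have x1 : 0 <= 1 - c / n%:R * u.
  by rewrite subr_ge0 mulr_ile1 ?divr_ge0 ?ler_pdivrMr ?mul1r // ltW.
rewrite lerXn2r ?nnegrE ?expR_ge0 //.
rewrite expRN -[leRHS]mul1r -[leLHS]mul1r ler_pdivrMr ?expR_gt0 // mul1r.
apply: le_trans (_ : (1 - c / n%:R * u) * (1 + c' * u / n%:R) <= _); last first.
  by rewrite ler_wpM2l // expR_ge1Dx.
rewrite -subr_ge0.
have -> : (1 - c / n%:R * u) * (1 + c' * u / n%:R) - 1 =
    u * (((c' - c) * n%:R - c * c' * u) / n%:R ^+ 2) by field; rewrite gt_eqF.
apply: mulr_ge0 => //; apply: divr_ge0; last by rewrite exprn_ge0 // ltW.
rewrite subr_ge0; by apply: le_trans le_n; rewrite ler_piMr // mulr_ge0 // ltW.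
Qed.

(** The term [m = 0] vanishes and every other term carries exactly one factor [1 / n]; the number of
    terms, [L + 1], is at most [2 ^ L]. *)
Lemma dense_sum_le (c : R) (b n L : nat) : 0 <= c <= 2 ^+ b -> (0 < n)%N -> (0 < L)%N ->
  \sum_(m < L.+1) (m * n ^ m.-1 * 2 ^ (m * m))%:R * (c / n%:R) ^+ m <=
  2 ^+ ((b + 3) * L ^ 2) / n%:R.
Proof.
move=> /andP[c0 cb] n0 L0; have nR : 0 < n%:R :> R by rewrite ltr0n.
apply: le_trans (_ : \sum_(m < L.+1) 2 ^+ (L + L * L + b * L) / n%:R <= _).
  apply: ler_sum => -[[|m] /= ltm] _.
    by rewrite !mul0n mul0r divr_ge0 ?exprn_ge0 // ltW.
  have -> : (m.+1 * n ^ m * 2 ^ (m.+1 * m.+1))%:R * (c / n%:R) ^+ m.+1 =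
      m.+1%:R * 2 ^+ (m.+1 * m.+1) * c ^+ m.+1 / n%:R.
    rewrite !natrM !natrX expr_div_n [n%:R ^+ m.+1]exprS; field.
    by rewrite expf_neq0 gt_eqF.
  rewrite ler_wpM2r ?invr_ge0 ?(ltW nR) // !exprD.
  apply: ler_pM; rewrite ?mulr_ge0 ?exprn_ge0 ?ler0n //.
    apply: ler_pM; rewrite ?exprn_ge0 ?ler0n //.
      rewrite -natrX ler_nat; apply: leq_trans (ltnW (ltn_expl L (isT : 1 < 2)%N)).
      by rewrite -ltnS.
    by rewrite ler_eXn2l ?leq_mul ?ltr1n // -ltnS.
  apply: le_trans (_ : (2 ^+ b) ^+ m.+1 <= _).
    by rewrite lerXn2r // nnegrE exprn_ge0.
  by rewrite -exprM ler_eXn2l ?ltr1n // leq_mul2l -ltnS ltm orbT.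
rewrite sumr_const card_ord -[leLHS]mulr_natl mulrA ler_wpM2r ?invr_ge0 ?(ltW nR) //.
apply: le_trans (_ : 2 ^+ L * 2 ^+ (L + L * L + b * L) <= _).
  by rewrite ler_wpM2r ?exprn_ge0 // -natrX ler_nat ltn_expl.
rewrite -exprD ler_eXn2l ?ltr1n //.
have : (L * 1 <= L * L)%N by rewrite leq_mul2l L0 orbT.
by rewrite -mulnn; nia.
Qed.

End Bounds.

(** * Combining the bounds with the choice of depth *)

Section Conclusion.
Variables (R : realType) (d : nat) (c : R).
Hypotheses (d2 : (2 <= d)%N) (c0 : 0 <= c).

Lemma near_density : \forall n \near \oo,
  [/\ (0 < n)%N, c <= n%:R, 0 <= c / n%:R <= 1 & c / n%:R <= 1 / 2].
Proof.
near=> n.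
have n0 : (0 < n)%N by near: n; exists 1%N.
have nR : 0 < n%:R :> R by rewrite ltr0n.
have cn : 2 * c <= n%:R by near: n; apply: nbhs_infty_ger.
have p2 : c / n%:R <= 1 / 2 by rewrite ler_pdivrMr //; lra.
have p0 : 0 <= c / n%:R by rewrite divr_ge0 // ltW.
have c0' := c0; split=> //; first lra.
by rewrite p0 (le_trans p2) //; lra.
Unshelve. all: by end_near.
Qed.

(** Membership in the family is included, so this is the failure event before dividing by
    [Pr[Y in F]]. *)
Definition not_collapsible n S := in_F d S && ~~ `[< @d_collapsible n d S >].

Lemma Pr_not_collapsible K : c < gamma_d R d ->
  \forall n \near \oo,
    Pr (c / n%:R) (dfaces n d) (@not_collapsible n) <= 2 * (1 / 2) ^+ K.
Proof.
(* A midpoint still below [gamma_d]; the gap to [c] pays for replacing [(1 - c u / n)^n] by an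
   exponential. *)
move=> cg; pose c' := (c + gamma_d R d) / 2.
have cc' : 0 <= c < c' by rewrite c0 /c'; lra.
have c'0 : 0 <= c' by case/andP: cc' => _ /ltW; apply: le_trans.
have c'g : c' < gamma_d R d by rewrite /c'; lra.
have [r0 small] := collapse_seq_double_exp c'0 d2 c'g.
have [b cb] : exists b, c <= 2 ^+ b.
  exists (Num.bound c); apply: le_trans (ltW (archi_boundP c0)) _.
  have := ltnW (ltn_expl (Num.bound c) (isT : 1 < 2)%N).
  by rewrite -(ler_nat R) natrX.
pose k n := trunc_log 2 (trunc_log 2 n).
(* [r0] levels reach the doubly exponential regime, [k n] is about log log n, and [2 d + 1] more
   beat the [n ^ d] roots. *)
pose r n := (r0 + (k n + d.*2.+1))%N.
pose L n := (1 + d.+1 * (r n + r n))%N.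
pose A := (1 + d.+1 * 2 * (r0 + d.*2.+2))%N.
have [k0 bigk] := sqr_le_exp2 ((b + 3) * A ^ 2).
near=> n.
have [n0 cn p01 p2] : [/\ (0 < n)%N, c <= n%:R, 0 <= c / n%:R <= 1 & c / n%:R <= 1 / 2].
  by near: n; apply: near_density.
have nR : 0 < n%:R :> R by rewrite ltr0n.
have n2 : (2 <= n)%N by near: n; exists 2%N.
have kn : (k0 + K <= k n)%N.
  rewrite /k; do 2 (apply: trunc_log_max => //).
  by near: n; exists (2 ^ 2 ^ (k0 + K))%N.
have cn2 : c * c' <= (c' - c) * n%:R.
  case/andP: cc' => _ lt; rewrite [leRHS]mulrC -ler_pdivrMr ?subr_gt0 //.
  by near: n; apply: nbhs_infty_ger.
have /andP[len gen] := double_trunc_log n2.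
rewrite -/(k n) in len gen.
have kbig := bigk (k n) (leq_trans (leq_addr _ _) kn).
have half01 : 0 <= (1 / 2 : R) <= 1 by lra.
have half_le m : (k n <= m)%N -> (1 / 2) ^+ m <= (1 / 2) ^+ K :> R.
  move=> lem; apply: ler_wiXn2l; [by lra|by lra|].
  by apply: leq_trans (leq_trans (leq_addl _ _) kn) lem.
pose D := dfaces n d.
pose dense (S : {set {set 'I_n}}) := [exists W : {set {set 'I_n}},
  [&& W \subset D, (#|W| <= L n)%N & (#|finset.cover W| < #|W|)%N] && (W \subset S)].
pose treed (S : {set {set 'I_n}}) := [exists t : {set 'I_n}, (#|t| == d) && tree (r n) t S].
apply: le_trans (_ : Pr (c / n%:R) D (fun S => dense S || treed S) <= _).
  apply: Pr_le => // S SD /andP[FS /asboolP ncS].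
  exact: collapse_dichotomy SD FS ncS (leqnn _).
apply: le_trans (Pr_or p01 _ _ _) _; rewrite mulr_natl mulr2n lerD //.
  apply: le_trans (Pr_dense p01 D (L n) n0) _.
  have c0b : 0 <= c <= 2 ^+ b by rewrite c0 cb.
  apply: le_trans (dense_sum_le c0b n0 (isT : 0 < L n)%N) _.
  have leL : (L n <= A * (k n).+1)%N by apply: affine_le_mulS.
  apply: le_trans (half_le _ (leqnn _)).
  (* It remains to fit the exponent of the first-moment bound plus [k n] below [2 ^ k n], which is
     [kbig]. *)
  rewrite ler_pdivrMr // div1r exprVn mulrC ler_pdivlMr ?exprn_gt0 // -exprD.
  apply: le_trans (_ : 2 ^+ (2 ^ k n) <= _); last by rewrite -natrX ler_nat.
  rewrite ler_eXn2l ?ltr1n //; apply: leq_trans kbig.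
  by rewrite leq_add2r -mulnA leq_mul2l -expnMn leq_sqr leL orbT.
apply: le_trans (Pr_exists p01 (fun t : {set 'I_n} => #|t| == d) D (tree (r n))) _.
apply: le_trans (_ : \sum_(t : {set 'I_n} | #|t| == d) (1 / 2) ^+ (2 ^ (k n + d.*2.+1)) <= _).
  apply: ler_sum => t /eqP ct; apply: le_trans (small _).
  apply: (Pr_tree p01 (g := fun u => 1 - expR (- (c' * u)))) => //.
  - by move=> j; apply: collapse_seq01.
  - by move=> u u01; rewrite lerB // expR_le_pow.
rewrite sumr_const.
have -> : #|[pred t : {set 'I_n} | #|t| == d]| = 'C(n, d).
  by have := card_draws 'I_n d; rewrite cardsE card_ord.
rewrite -[leLHS]mulr_natl; apply: le_trans (half_le _ (leqnn _)).
pose N := (2 ^ (k n).+1 * d)%N.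
have leN : 'C(n, d)%:R <= 2 ^+ N :> R.
  rewrite -natrX ler_nat; apply: leq_trans (bin_le_exp _ _) _.
  by rewrite /N expnM leq_exp2r // ltnW.
apply: le_trans (_ : 2 ^+ N * (1 / 2) ^+ (N + k n) <= _).
  apply: ler_pM => //.
  by apply: ler_wiXn2l (exp2_gap d (k n)); lra.
have two_half : 2 * (1 / 2) = 1 :> R by lra.
by rewrite exprD mulrA -exprMn two_half expr1n [leLHS]mul1r.
Unshelve. all: by end_near.
Qed.

(** The bound of [Pr_in_F] is [(1 - C / N)^N] with [C = c ^+ d.+2] and [N = n ^ d.+2]; [expR_le_pow]
    applies with [C + 1] and [u = 1]. *)
Lemma Pr_in_F_ge : \forall n \near \oo,
  expR (- (c ^+ d.+2 + 1)) <= Pr (c / n%:R) (dfaces n d) (@in_F n d).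
Proof.
pose C := c ^+ d.+2; have C0 : 0 <= C by rewrite exprn_ge0.
near=> n.
have [n0 cn p01 p2] : [/\ (0 < n)%N, c <= n%:R, 0 <= c / n%:R <= 1 & c / n%:R <= 1 / 2].
  by near: n; apply: near_density.
have Cn : C * (C + 1) + C <= n%:R by near: n; apply: nbhs_infty_ger.
have nN : n%:R <= (n ^ d.+2)%:R :> R.
  by rewrite ler_nat -{1}(expn1 n) leq_pexp2l.
apply: le_trans (Pr_in_F n d p01).
have -> : (c / n%:R) ^+ d.+2 = C / (n ^ d.+2)%:R * 1 by rewrite expr_div_n natrX mulr1.
rewrite -[C + 1]mulr1; apply: expR_le_pow; rewrite ?ler01 ?lexx ?expn_gt0 ?n0 //.
- by rewrite C0 ltrDl ltr01.
- by have := mulr_ge0 C0 (ltW (ltr_wpDl C0 ltr01)); lra.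
- by rewrite [C + 1]addrC addrK mul1r [1 + C]addrC; lra.
Unshelve. all: by end_near.
Qed.

End Conclusion.

Theorem theorem4 (R : realType) (d : nat) (c : R) :
  (2 <= d)%N -> 0 <= c -> c < gamma_d R d ->
  @Ycondprob R n d (c / n%:R)
     (fun S => `[< d_collapsible d S >]) (fun S => in_F d S)
    @[n --> \oo] --> (1 : R).
Proof.
move=> d2 c0 cg; apply/cvgrPdist_le => e e0.
pose b := expR (- (c ^+ d.+2 + 1)); have b0 : 0 < b by apply: expR_gt0.
(* Since [Pr[Y in F] >= b], failure of probability at most [e * b] has conditional probability at
   most [e]. *)
have [K leK] : exists K, 2 * (1 / 2) ^+ K <= e * b.
  exists (Num.bound (2 / (e * b))); set K := Num.bound _.
  have eb0 : 0 < e * b by apply: mulr_gt0.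
  have ltK : 2 / (e * b) < K%:R by apply: archi_boundP; rewrite divr_ge0 // ltW.
  have := ltnW (ltn_expl K (isT : 1 < 2)%N); rewrite -(ler_nat R) natrX.
  rewrite div1r exprVn ler_pdivrMr ?exprn_gt0 // mulrC -ler_pdivrMr //.
  by apply/le_trans/ltW.
near=> n.
have [n0 cn p01 p2] : [/\ (0 < n)%N, c <= n%:R, 0 <= c / n%:R <= 1 & c / n%:R <= 1 / 2].
  by near: n; apply: near_density.
have bB : b <= Pr (c / n%:R) (dfaces n d) (@in_F n d) by near: n; apply: Pr_in_F_ge.
have nc : Pr (c / n%:R) (dfaces n d) (@not_collapsible d n) <= 2 * (1 / 2) ^+ K.
  by near: n; apply: Pr_not_collapsible.
rewrite /Ycondprob -[Yprob _ _ (fun S => in_F d S)]/(Pr (c / n%:R) (dfaces n d) (@in_F n d)).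
pose AB S := `[< @d_collapsible n d S >] && in_F d S.
rewrite -[Yprob _ _ _]/(Pr (c / n%:R) (dfaces n d) AB).
move: bB; set PB := Pr _ _ (@in_F n d) => bB.
have PB0 : 0 < PB by apply: lt_le_trans bB.
have leAB : Pr (c / n%:R) (dfaces n d) AB <= PB by apply: Pr_le => // S _ /andP[].
have leB : PB <= Pr (c / n%:R) (dfaces n d) AB + Pr (c / n%:R) (dfaces n d) (@not_collapsible d n).
  apply: le_trans (Pr_or p01 _ _ _); apply: Pr_le => // S _ FS.
  by rewrite /AB /not_collapsible FS andbT orbN.
rewrite ger0_norm; last by rewrite subr_ge0 ler_pdivrMr // mul1r.
rewrite lerBlDr -lerBlDl ler_pdivlMr // mulrBl mul1r.
have : e * b <= e * PB by rewrite ler_pM2l.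
lra.
Unshelve. all: by end_near.
Qed.
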